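(* Let $d\ge 2$ and $1\le k\le d+1$ be integers, $\beta$ real, and $\mathbf{x}\in T_d(k,\beta)$. Suppose $R_d\cup\{\mathbf{x}\}$ has only two distances $\sqrt{2}$ and $\sqrt{\alpha}$. Then: (1) If $\alpha<2$ and $s\ge 2$ satisfy $\alpha/2=(s-1)/s$, then $2\le k\le d$, $k\ne s^2$, $\beta=-1/s$, and \[ d=k+s^2-2s-1+\frac{s^2(s-1)^2}{k-s^2}. \] (2) If $\alpha>2$ and $s\ge 2$ satisfy $2/\alpha=(s-1)/s$, then $2\le k\le d$, $d+2\ge k+s$, $k\ne (s-1)^2$, $\beta=1/(s-1)$, and \[ d=k+s^2-2+\frac{s^2(s-1)^2}{k-(s-1)^2}. \]
   Context: For an integer $d\ge 2$, let $H_d=\{(x_1,\dots,x_{d+1})\in\mathbb{R}^{d+1}:\sum_i x_i=1\}$ with the Euclidean distance, and let $R_d=\{\mathbf{e}_1,\dots,\mathbf{e}_{d+1}\}$ be the standard basis vectors of $\mathbb{R}^{d+1}$ (a regular simplex in $H_d$ with all distances $\sqrt2$). For an integer $1\le k\le d+1$ and real $\beta$, put $c=(1-(d+1-k)\beta)/(d+1)$ and $T_d(k,\beta)=\{\mathbf{x}\in H_d: x_i\in\{c,c+\beta\}\text{ for all }i,\ |\{i:x_i=c\}|=k\}$. (The number $s$ is the LRS ratio: for a two-distance set with distances $a<b$, $a^2/b^2=(s-1)/s$.)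
   Formalization: As T_d(k,β)=T_d(d+1−k,−β) for β≠0 and k≤d, the literal claim fails (d=8, k=4, β=1/2, s=2); the conclusions are proved for whichever of (k,β), (d+1−k,−β) has x_i=c exactly when e_i is at distance √α from x. *)

(* Defs.v *)
From HB Require Import structures.
From mathcomp Require Import all_boot all_order all_algebra.
From mathcomp Require Import classical_sets reals.
Set Implicit Arguments.
Unset Strict Implicit.
Unset Printing Implicit Defensive.
Import Order.TTheory GRing.Theory Num.Theory.
Local Open Scope ring_scope.
Local Open Scope classical_set_scope.

Definition edist (R : realType) (n : nat) (x y : 'rV[R]_n) : R :=
  Num.sqrt (\sum_(i < n) (x 0 i - y 0 i) ^+ 2).

Definition distances (R : realType) (n : nat) (A : set 'rV[R]_n) : set R :=
  [set r | exists x y, [/\ A x, A y, x <> y & r = edist x y]].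

(* Both values must occur: a set with a single distance does not qualify. *)
Definition has_two_distances (R : realType) (n : nat) (A : set 'rV[R]_n)
    (a b : R) : Prop :=
  a <> b /\ distances A = [set a; b].

Definition Hd (R : realType) (d : nat) : set 'rV[R]_d.+1 :=
  [set x | \sum_(i < d.+1) x 0 i = 1].

Definition Rd (R : realType) (d : nat) : set 'rV[R]_d.+1 :=
  [set x | exists i : 'I_d.+1, x = delta_mx 0 i].
Arguments Rd R d : clear implicits.

Definition cd (R : realType) (d k : nat) (beta : R) : R :=
  (1 - (d.+1%:R - k%:R) * beta) / d.+1%:R.
Arguments cd {R} d k beta.

(* For beta != 0, Td d k beta = Td d (d.+1 - k) (- beta): the two coordinate   *)
(* values c and c + beta exchange roles.                                       *)
Definition Td (R : realType) (d k : nat) (beta : R) : set 'rV[R]_d.+1 :=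
  [set x | [/\ Hd x,
               forall i, x 0 i = cd d k beta \/ x 0 i = cd d k beta + beta
             & #|[pred i : 'I_d.+1 | x 0 i == cd d k beta]| = k]].
Arguments Td {R} d k beta.

(* Main.v *)
Require Import Defs.
From HB Require Import structures.
From mathcomp Require Import all_boot all_order all_algebra.
From mathcomp Require Import classical_sets reals.
From mathcomp Require Import ring lra.
Set Implicit Arguments.
Unset Strict Implicit.
Unset Printing Implicit Defensive.
Import Order.TTheory GRing.Theory Num.Theory.
Local Open Scope ring_scope.
Local Open Scope classical_set_scope.

(** Since [|x - e_i|^2 = |x|^2 - 2 x_i + 1] depends on [i] only through [x_i],
    the coordinate value of [x] tells whether [e_i] is at distance [sqrt 2] or
    [sqrt alpha]; exchanging the two values if necessary, [x_i = c] for the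
    latter.  Subtracting the two squared distances gives [alpha = 2 + 2 beta],
    and eliminating [c] from [sum_i x_i = 1] and [|x|^2 = 2 (c + beta) + 1]
    gives [(d + 1) (k beta^2 - 1) = (1 + k beta)^2], from which everything
    follows by substituting the value of [beta].  The case [k = d + 1] is
    excluded because [x] is then the centroid, for which [alpha < 1]. *)

Section Distances.
Variables (R : realType).

Lemma sqr_edist n (x y : 'rV[R]_n) :
  edist x y ^+ 2 = \sum_(i < n) (x 0 i - y 0 i) ^+ 2.
Proof. by rewrite sqr_sqrtr // sumr_ge0 // => i _; apply: sqr_ge0. Qed.

Lemma edist_sym n (x y : 'rV[R]_n) : edist x y = edist y x.
Proof. by congr Num.sqrt; apply: eq_bigr => i _; rewrite -sqrrN opprB. Qed.

Lemma sqr_edist_delta n (x : 'rV[R]_n) (i : 'I_n) :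
  edist x (delta_mx 0 i) ^+ 2 = \sum_(j < n) x 0 j ^+ 2 - 2 * x 0 i + 1.
Proof.
rewrite sqr_edist (bigD1 i) //= [in RHS](bigD1 i) //= mxE !eqxx /=.
rewrite (eq_bigr (fun j => x 0 j ^+ 2)); first by ring.
by move=> j ji; rewrite mxE (negbTE ji) andbF subr0.
Qed.

Lemma edist_delta_delta n (i j : 'I_n) : i != j ->
  edist (delta_mx 0 i : 'rV[R]_n) (delta_mx 0 j) = Num.sqrt 2.
Proof.
move=> ij; apply/eqP; rewrite -(eqrXn2 (n := 2)) ?sqrtr_ge0 //.
rewrite sqr_edist_delta sqr_sqrtr // (bigD1 i) //= big1 => [|l li].
  by rewrite !mxE !eqxx [j == i]eq_sym (negbTE ij) /=; apply/eqP; ring.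
by rewrite mxE (negbTE li) andbF expr0n.
Qed.

(** Vertices are mutually at distance [Num.sqrt 2], so only a pair containing [x] can realise
    [Num.sqrt alpha]. Hence [x] is not itself a vertex, and its distance to every vertex is one of
    the two. *)
Lemma two_distancesP d (alpha : R) (x : 'rV[R]_d.+1) :
  has_two_distances (Rd R d `|` [set x]) (Num.sqrt 2) (Num.sqrt alpha) ->
  [/\ Num.sqrt alpha <> Num.sqrt 2,
      exists i, edist x (delta_mx 0 i) = Num.sqrt alpha
    & forall i, edist x (delta_mx 0 i) = Num.sqrt alpha \/
                edist x (delta_mx 0 i) = Num.sqrt 2].
Proof.
move=> [neq dist].
have Rd_dist i j : (delta_mx 0 i : 'rV[R]_d.+1) <> delta_mx 0 j ->
    edist (delta_mx 0 i : 'rV[R]_d.+1) (delta_mx 0 j) = Num.sqrt 2.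
  by move=> ij; apply: edist_delta_delta; apply/eqP => e; apply: ij; rewrite e.
have [i xi ei] : exists2 i, x <> delta_mx 0 i &
    edist x (delta_mx 0 i) = Num.sqrt alpha.
  have : distances (Rd R d `|` [set x]) (Num.sqrt alpha) by rewrite dist; right.
  move=> [u [v [[[i ->]|->] [[j ->]|->] uv e]]] //.
  - by case: neq; rewrite e Rd_dist.
  - by exists i; [move/esym|rewrite edist_sym].
  - by exists j.
have xNRd j : x <> delta_mx 0 j.
  by move=> xj; case: neq; rewrite -ei xj Rd_dist // -xj.
split; [by move/esym|by exists i|move=> j].
have : distances (Rd R d `|` [set x]) (edist x (delta_mx 0 j)).
  by exists x, (delta_mx 0 j); split=> //; [right|left; exists j].
by rewrite dist => -[]; [right|left].
Qed.

(** Taking the square for [f] expresses |x|^2 through c, beta, k and d. *)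
Lemma sum_Td d k (beta : R) x (f : R -> R) : Td d k beta x ->
  \sum_i f (x 0 i) =
  k%:R * f (cd d k beta) + (d.+1%:R - k%:R) * f (cd d k beta + beta).
Proof.
move=> [_ val card]; set c := cd d k beta in val card *.
have card' : (#|[pred i | x 0 i != c]|)%:R = d.+1%:R - k%:R :> R.
  have /(congr1 (fun n => n%:R : R)) := cardC [pred i | x 0 i == c].
  by rewrite card card_ord natrD => <-; rewrite addrC addKr.
rewrite (bigID (fun i => x 0 i == c)) /=; congr (_ + _).
  rewrite (eq_bigr (fun=> f c)) => [|i /eqP -> //].
  by rewrite sumr_const card mulr_natl.
rewrite (eq_bigr (fun=> f (c + beta))) => [|i]; last first.
  by case: (val i) => -> //; rewrite eqxx.
by rewrite sumr_const -card' mulr_natl.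
Qed.

Lemma cdE d k (beta : R) :
  d.+1%:R * cd d k beta = 1 - (d.+1%:R - k%:R) * beta.
Proof. by rewrite /cd mulrCA divff ?mulr1 ?pnatr_eq0. Qed.

Lemma cd_swap d k (beta : R) : (k <= d.+1)%N ->
  cd d (d.+1 - k) (- beta) = cd d k beta + beta.
Proof.
move=> kd; have n0 : d.+1%:R != 0 :> R by rewrite pnatr_eq0.
by apply: (mulfI n0); rewrite mulrDr !cdE natrB //; ring.
Qed.

(** A nonzero [beta] separates c from c + beta, so the coordinates equal to c + beta are exactly the
    d + 1 - k ones different from c. *)
Lemma Td_swap d k (beta : R) x : (k <= d.+1)%N -> beta != 0 ->
  Td d k beta x -> Td d (d.+1 - k) (- beta) x.
Proof.
move=> kd b0 [hx val card]; rewrite /Td/= cd_swap // addrK; split=> //.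
  by move=> i; case: (val i); [right|left].
have := cardC [pred i | x 0 i == cd d k beta]; rewrite card card_ord.
move=> /(congr1 (subn^~ k)) /=; rewrite addKn => <-.
apply: eq_card => i; rewrite !inE.
case: (val i) => ->; rewrite ?eqxx /=.
  by rewrite -subr_eq0 opprD addNKr oppr_eq0 (negbTE b0).
by apply/esym; rewrite -subr_eq0 addrC addKr.
Qed.

Lemma Td_full d (beta : R) x i : Td d d.+1 beta x -> x 0 i = cd d d.+1 beta.
Proof.
case=> _ _ card; apply/eqP.
have : #|[pred i : 'I_d.+1 | x 0 i == cd d d.+1 beta]| = #|'I_d.+1|.
  by rewrite card card_ord.
by move/fintype.subset_cardP => /(_ (fintype.subset_predT _)) /(_ i).
Qed.

(** All coordinates equal c = 1/(d+1), so |x|^2 = c and alpha = c - 2c + 1 = 1 - c. *)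
Lemma Td_centroid_dist d (beta alpha : R) x i : 0 < alpha ->
  Td d d.+1 beta x -> edist x (delta_mx 0 i) = Num.sqrt alpha -> alpha < 1.
Proof.
move=> a0 Tx e; have := sqr_edist_delta x i.
rewrite e sqr_sqrtr ?ltW // (sum_Td (fun t => t ^+ 2) Tx) (Td_full i Tx).
rewrite subrr mul0r.
have := cdE d d.+1 beta; rewrite subrr mul0r subr0.
move: (cd _ _ _) => c; have : 0 < d.+1%:R :> R by rewrite ltr0n.
move: (d.+1%:R) => n n0 nc; rewrite addr0 expr2 mulrA nc.
have : 0 < c by rewrite -(pmulr_rgt0 _ n0) nc.
lra.
Qed.

Lemma Td_two_distances d k (beta alpha : R) x : 0 < alpha ->
  Td d k beta x -> (1 <= k <= d)%N ->
  Num.sqrt alpha <> Num.sqrt 2 ->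
  (forall i, edist x (delta_mx 0 i) = Num.sqrt alpha \/
             edist x (delta_mx 0 i) = Num.sqrt 2) ->
  (forall i, x 0 i = cd d k beta <->
             edist x (delta_mx 0 i) = Num.sqrt alpha) ->
  alpha = 2 + 2 * beta /\
  (d%:R + 1) * (k%:R * beta ^+ 2 - 1) = (1 + k%:R * beta) ^+ 2.
Proof.
move=> a0 Tx /andP[k1 kd] neq two iffc.
have [hx val card] := Tx.
(* The bounds 1 <= k <= d supply a vertex of each kind: [i] at distance [Num.sqrt alpha] and [j] at
   distance [Num.sqrt 2]. *)
have [i /eqP ci] : exists i, x 0 i == cd d k beta.
  by move: k1; rewrite -[X in (0 < X)%N]card => /card_gt0P[i]; exists i.
have [j cj] : exists j, x 0 j != cd d k beta.
  apply/existsP; rewrite -negb_forall; apply: contraL kd => /forallP all.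
  by rewrite -ltnNge -card (eq_card (B := 'I_d.+1)) ?card_ord.
have := sqr_edist_delta x i; rewrite (iffc i).1 // sqr_sqrtr ?ltW // ci.
have := sqr_edist_delta x j.
have -> : edist x (delta_mx 0 j) = Num.sqrt 2.
  by case: (two j) => // /(iffc j).2 /eqP; rewrite (negbTE cj).
have -> : x 0 j = cd d k beta + beta.
  by case: (val j) => // /eqP; rewrite (negbTE cj).
rewrite sqr_sqrtr // (sum_Td (fun t => t ^+ 2) Tx).
have := cdE d k beta; rewrite -natr1.
move: (cd _ _ _) (d%:R) (k%:R) => c n m nc e2 ea; split; first lra.
have ny : (n + 1) * (c + beta) = 1 + m * beta by rewrite mulrDr nc; ring.
(* With y = c + beta, [e2] reads 1 = (n+1) y^2 - 2 m beta y + m beta^2 - 2y. Multiplying [ny] by y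
   replaces (n+1) y^2 by y + m beta y. *)
have e3 : m * beta ^+ 2 - 1 = (c + beta) * (1 + m * beta).
  by have /(congr1 (fun t => t * (c + beta))) := ny; lra.
by rewrite e3 mulrA ny expr2.
Qed.

(** Here [n] stands for d + 1. Clearing denominators gives n (k - s^2) = (s - k)^2: k = s^2 would
    force s = s^2, and k = 1 would make the left side negative. *)
Lemma case_alpha_lt2 (n k s beta : R) : 0 < n -> 1 <= k -> 2 <= s ->
  beta = - (1 / s) -> n * (k * beta ^+ 2 - 1) = (1 + k * beta) ^+ 2 ->
  [/\ k <> 1, k <> s ^+ 2 &
      n = k + s ^+ 2 - 2 * s + s ^+ 2 * (s - 1) ^+ 2 / (k - s ^+ 2)].
Proof.
move=> n0 k1 s2 -> e.
have s0 : s != 0 by apply/eqP; lra.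
have {}e : n * (k - s ^+ 2) = (s - k) ^+ 2.
  have /(congr1 (fun t => s ^+ 2 * t)) := e.
  have -> : s ^+ 2 * (n * (k * (- (1 / s)) ^+ 2 - 1)) =
    n * (k - s ^+ 2) by field.
  by move=> ->; field.
have ks : k <> s ^+ 2.
  move=> ks; move: e; rewrite ks subrr mulr0 => /esym/eqP.
  by rewrite sqrf_eq0 => /eqP; nra.
split=> //; first by move=> k1'; rewrite k1' in e; nra.
have ks0 : k - s ^+ 2 != 0 by rewrite subr_eq0; apply/eqP.
by apply: (mulIf ks0); rewrite e; field.
Qed.

(** Again n = d + 1. Now n (k - (s-1)^2) = (s - 1 + k)^2 is positive, so k > (s-1)^2 >= 1. *)
Lemma case_alpha_gt2 (n k s beta : R) : 0 < n -> 1 <= k -> 2 <= s ->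
  beta = 1 / (s - 1) -> n * (k * beta ^+ 2 - 1) = (1 + k * beta) ^+ 2 ->
  [/\ k <> 1, k + s <= n + 1, k <> (s - 1) ^+ 2 &
      n = k + s ^+ 2 - 1 + s ^+ 2 * (s - 1) ^+ 2 / (k - (s - 1) ^+ 2)].
Proof.
move=> n0 k1 s2 -> e.
have s0 : s - 1 != 0 by apply/eqP; lra.
have {}e : n * (k - (s - 1) ^+ 2) = (s - 1 + k) ^+ 2.
  have /(congr1 (fun t => (s - 1) ^+ 2 * t)) := e.
  have -> : (s - 1) ^+ 2 * (n * (k * (1 / (s - 1)) ^+ 2 - 1)) =
    n * (k - (s - 1) ^+ 2) by field.
  by move=> ->; field.
have sk : 0 < s - 1 + k by lra.
have : 0 < n * (k - (s - 1) ^+ 2) by rewrite e exprn_gt0.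
rewrite pmulr_rgt0 // => ks.
have ks0 : k - (s - 1) ^+ 2 != 0 by rewrite gt_eqF.
split.
- by move=> k1'; rewrite k1' in ks; nra.
(* If n < s - 1 + k, cancelling s - 1 + k in the equation [e] leaves s - 1 + k < k - (s-1)^2, which
   is absurd. *)
- rewrite leNgt; apply/negP => lt.
  have lt1 : n * (k - (s - 1) ^+ 2) < (s - 1 + k) * (k - (s - 1) ^+ 2).
    by rewrite ltr_pM2r //; lra.
  move: lt1; rewrite e expr2 ltr_pM2l //.
  by have := sqr_ge0 (s - 1); lra.
- by move=> k'; rewrite k' subrr eqxx in ks0.
- by apply: (mulIf ks0); rewrite e; field.
Qed.

End Distances.

(* The pair (k', beta') is (k, beta) up to the relabelling                     *)
(* Td d k beta = Td d (d.+1 - k) (- beta), chosen so that the coordinates      *)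
(* equal to c are those of the vertices at distance sqrt alpha from x.         *)
Theorem theorem3p1 (R : realType) (d k : nat) (beta alpha : R)
    (x : 'rV[R]_d.+1)
    (hd : (2 <= d)%N) (hk : (1 <= k <= d.+1)%N)
    (hx : Td d k beta x)
    (h2 : has_two_distances (Rd R d `|` [set x])
            (Num.sqrt 2) (Num.sqrt alpha)) :
  exists (k' : nat) (beta' : R),
    [/\ (k' = k /\ beta' = beta) \/ (k' = (d.+1 - k)%N /\ beta' = - beta),
        (1 <= k' <= d.+1)%N /\ Td d k' beta' x,
        forall i : 'I_d.+1,
          x 0 i = cd d k' beta' <->
          edist x (delta_mx 0 i) = Num.sqrt alpha,
        forall s : R, alpha < 2 -> 2 <= s -> alpha / 2 = (s - 1) / s ->
          [/\ (2 <= k' <= d)%N, k'%:R <> s ^+ 2, beta' = - (1 / s)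
            & d%:R = k'%:R + s ^+ 2 - 2 * s - 1
                     + s ^+ 2 * (s - 1) ^+ 2 / (k'%:R - s ^+ 2)]
      & forall s : R, 2 < alpha -> 2 <= s -> 2 / alpha = (s - 1) / s ->
          [/\ (2 <= k' <= d)%N, k'%:R + s <= d%:R + 2,
              k'%:R <> (s - 1) ^+ 2, beta' = 1 / (s - 1)
            & d%:R = k'%:R + s ^+ 2 - 2
                     + s ^+ 2 * (s - 1) ^+ 2 / (k'%:R - (s - 1) ^+ 2)]].
Proof.
have [neq [i0 ei0] two] := two_distancesP h2.
have [k' [beta' [rel hk' Tx iffc]]] : exists k' beta',
  [/\ (k' = k /\ beta' = beta) \/ (k' = (d.+1 - k)%N /\ beta' = - beta),
      (1 <= k' <= d.+1)%N, Td d k' beta' x &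
      forall i : 'I_d.+1, x 0 i = cd d k' beta' <->
                          edist x (delta_mx 0 i) = Num.sqrt alpha].
  (* The vertices at distance [Num.sqrt alpha] are those sharing the coordinate value of the witness
     [i0]; that value decides whether to relabel. *)
  have iff0 : forall i, x 0 i = x 0 i0 <->
                        edist x (delta_mx 0 i) = Num.sqrt alpha.
    move=> i; split=> [xi|ei].
      apply/eqP; rewrite -ei0 -(eqrXn2 (n := 2)) ?sqrtr_ge0 //.
      by rewrite !sqr_edist_delta xi.
    by have := sqr_edist_delta x i; rewrite ei -ei0 sqr_edist_delta; lra.
  have [_ val _] := hx; have /andP[k1 kd] := hk.
  have [xi0|xi0] := eqVneq (x 0 i0) (cd d k beta).
    by exists k, beta; split=> //; [left|rewrite -xi0].
  have {}val : x 0 i0 = cd d k beta + beta.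
    by case: (val i0) => // /eqP; rewrite (negbTE xi0).
  have b0 : beta != 0 by apply: contraNneq xi0 => b0; rewrite val b0 addr0.
  exists (d.+1 - k)%N, (- beta); split; [by right| |exact: Td_swap|].
    (* If k were d + 1, every coordinate would equal c, against the choice of [i0]. *)
    rewrite leq_subr andbT subn_gt0 ltn_neqAle kd andbT.
    apply: contraNneq xi0 => kE; rewrite kE in hx *.
    by apply/eqP; apply: Td_full.
  by rewrite cd_swap // -val.
have /andP[k1 kd] := hk'.
(* The threshold 1 rules out the centroid. It is met in both cases: when alpha < 2, s >= 2 gives
   alpha = 2 - 2/s >= 1. *)
have core : 1 <= alpha -> [/\ (k' <= d)%N, alpha = 2 + 2 * beta' &
    (d%:R + 1) * (k'%:R * beta' ^+ 2 - 1) = (1 + k'%:R * beta') ^+ 2].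
  move=> a1; have a0 : 0 < alpha by lra.
  have kd' : (k' <= d)%N.
    rewrite -ltnS ltn_neqAle kd andbT; apply/eqP => kE; rewrite kE in Tx.
    by have := Td_centroid_dist a0 Tx ei0; rewrite ltNge a1.
  by have [] // := Td_two_distances a0 Tx _ neq two iffc; rewrite k1.
have k1R : 1 <= k'%:R :> R by rewrite ler1n.
have n0 : 0 < d%:R + 1 :> R by rewrite natr1 ltr0n.
exists k', beta'; split=> //.
- move=> s a2 s2 as2; have s0 : s != 0 by apply/eqP; lra.
  (* Comparison with [alpha = 2 + 2 * beta'] from [core] will determine [beta']. *)
  have aE : alpha = 2 + 2 * - (1 / s).
    by rewrite -[alpha](@divfK _ 2) ?pnatr_eq0 // as2; field.
  have is2 : 1 / s <= 1 / 2 by rewrite !div1r lef_pV2 ?posrE //; lra.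
  have [|kd' ab eq] := core; first lra.
  have bE : beta' = - (1 / s) by lra.
  have [kN1 ks nE] := case_alpha_lt2 n0 k1R s2 bE eq.
  split=> //; last by lra.
  rewrite kd' andbT ltn_neqAle k1 andbT; apply/eqP => k1'.
  by case: kN1; rewrite -k1'.
- move=> s a2 s2 as2.
  have s0 : s != 0 by apply/eqP; lra.
  have s1 : s - 1 != 0 by apply/eqP; lra.
  have aE : alpha = 2 + 2 * (1 / (s - 1)).
    have a0 : alpha != 0 by apply/eqP; lra.
    move/eqP: as2; rewrite eqr_div // => /eqP as2.
    apply: (mulIf s1); rewrite mulrC -as2.
    by field.
  have [|kd' ab eq] := core; first lra.
  have bE : beta' = 1 / (s - 1) by lra.
  have [kN1 le ks nE] := case_alpha_gt2 n0 k1R s2 bE eq.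
  split=> //; [|by lra|by lra].
  rewrite kd' andbT ltn_neqAle k1 andbT; apply/eqP => k1'.
  by case: kN1; rewrite -k1'.
Qed.
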